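(* Let $N\ge1$, let $p,\ell$ be distinct primes with $p\mid N$ and $\ell\nmid N$, and let $s$ be a positive integer. Then for every $f\in\mathcal{M}(N)$, $f|\mathcal{T}(p)\mathcal{T}(\ell^{s})=f|\mathcal{T}(\ell^{s})\mathcal{T}(p)$. In particular, $f|\mathcal{T}(p^{r})\mathcal{T}(\ell^{s})=f|\mathcal{T}(\ell^{s})\mathcal{T}(p^{r})$ for all $r\ge1$.
   Context: Let $q=e^{2\pi i\tau}$. $\mathcal{M}(N)$ denotes the multiplicative group of meromorphic modular forms $f$ on the upper half-plane of some integer weight $k$ for $\Gamma_0(N)$ with some unitary multiplier system (i.e. $f(\gamma\tau)=\chi(\gamma)(c\tau+d)^kf(\tau)$ for $\gamma\in\Gamma_0(N)$, $\chi:\Gamma_0(N)\to S^1$, meromorphic at cusps), with integer Fourier coefficients at $i\infty$ and leading coefficient $1$. With $(f|_k\gamma)(\tau)=\det(\gamma)^{k/2}(c\tau+d)^{-k}f(\gamma\tau)$, for a prime $p$, $r\ge1$ and $f\in\mathcal{M}(N)$ of weight $k$: $$f|\mathcal{T}(p^{r}):=\begin{cases}\varepsilon\, p^{\frac{k}{1-p}\left(\frac{p^{r+1}-p}{p-1}-\frac{r}{2}(p^{r+1}+1)\right)}\prod_{ad=p^{r},\,0\le b<d}f|_{k}\begin{pmatrix}a&b\\0&d\end{pmatrix} & p\nmid N,\\ \varepsilon\, p^{\frac{rkp^{r}}{2}}\prod_{j=0}^{p^{r}-1}f|_{k}\begin{pmatrix}1&j\\0&p^{r}\end{pmatrix} &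 p\mid N,\end{cases}$$ with $a,d>0$ and $\varepsilon$ the constant making the leading coefficient 1; $f|\mathcal{T}(p^r)\in\mathcal{M}(N)$. $f|\mathcal{T}(a)\mathcal{T}(b)$ means $(f|\mathcal{T}(a))|\mathcal{T}(b)$, each operator using the weight of its argument. *)

(* Defs.v *)
From HB Require Import structures.
From mathcomp Require Import all_boot all_order all_algebra complex.
From mathcomp Require Import all_classical all_reals all_analysis.

Set Implicit Arguments.
Unset Strict Implicit.
Unset Printing Implicit Defensive.

Import Order.TTheory GRing.Theory Num.Theory.
Import numFieldNormedType.Exports.

Local Open Scope classical_set_scope.
Local Open Scope ring_scope.
Local Open Scope complex_scope.

(* The complex numbers are R[i]; their topology and complex differentiability
   come from the regular normed module R[i]^o over the field R[i].

   A meromorphic function on an open set U is represented by a total function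
   R[i] -> R[i]; its values at isolated points (in particular at poles) carry no
   information, so equality of meromorphic functions is mero_eq. *)

Definition mero_eq (R : realType) (U : set R[i]) (f g : R[i] -> R[i]) : Prop :=
  forall z : R[i], U z -> \forall w \near (z : R[i]^o)^', f w = g w.

Definition holomorphic_at (R : realType) (g : R[i] -> R[i]) (z : R[i]) : Prop :=
  \forall w \near (z : R[i]^o), derivable (g : R[i]^o -> R[i]^o) w (1 : R[i]^o).

Definition meromorphic_at (R : realType) (f : R[i] -> R[i]) (z : R[i]) : Prop :=
  exists (n : int) (g : R[i] -> R[i]),
    holomorphic_at g z /\
    (\forall w \near (z : R[i]^o)^', f w = (w - z) ^ n * g w).

(* The half-plane Im tau > A; upper_half 0 is the upper half-plane. *)
Definition upper_half (R : realType) (A : R) : set R[i] :=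
  [set z | A < complex.Im z].

Definition cexp (R : realType) (z : R[i]) : R[i] :=
  (expR (complex.Re z))%:C *
  (cos (complex.Im z) +i* sin (complex.Im z)).

(* e(z) = exp(2 pi i z), so that q = e(tau) and q^x = e(x tau) for real x. *)
Definition e2pi (R : realType) (z : R[i]) : R[i] :=
  cexp ((2 * pi)%:C * 'i * z).

(* f(tau) = q^h * \sum_(n >= 0) a_n q^(n/w) for Im tau large.  The exponent h is
   real because a unitary multiplier system only gives |chi(T)| = 1, where T is
   the translation by 1. *)
Definition fourier_expansion (R : realType) (w : nat) (h : R) (a : nat -> R[i])
    (f : R[i] -> R[i]) : Prop :=
  exists (A : R) (g : R[i] -> R[i]),
    [/\ 0 <= A,
        forall tau : R[i], upper_half A tau ->
          series (fun n => a n * e2pi (n%:R / w%:R * tau) : R[i]^o) @ \oo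
            --> (g tau : R[i]^o) &
        mero_eq (upper_half A) f (fun tau => e2pi (h%:C * tau) * g tau)].

Definition leading_coef (R : realType) (f : R[i] -> R[i]) (c : R[i]) : Prop :=
  c != 0 /\
  exists (w : nat) (h : R) (a : nat -> R[i]),
    [/\ (0 < w)%N, a 0%N = c & fourier_expansion w h a f].

Definition mx2 (a b c d : int) : 'M[int]_2 :=
  \matrix_(i, j) if i == 0 then (if j == 0 then a else b)
                 else (if j == 0 then c else d).

Definition autfac (R : realType) (g : 'M[int]_2) (tau : R[i]) : R[i] :=
  (g 1 0)%:~R * tau + (g 1 1)%:~R.

Definition moebius (R : realType) (g : 'M[int]_2) (tau : R[i]) : R[i] :=
  ((g 0 0)%:~R * tau + (g 0 1)%:~R) / autfac g tau.

Definition slash (R : realType) (k : int) (g : 'M[int]_2) (f : R[i] -> R[i])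
    (tau : R[i]) : R[i] :=
  (((\det g)%:~R : R) `^ (k%:~R / 2))%:C * autfac g tau ^ (- k)
  * f (moebius g tau).

Definition SL2Z (g : 'M[int]_2) : Prop := \det g = 1.

Definition Gamma0 (N : nat) (g : 'M[int]_2) : Prop :=
  SL2Z g /\ (N%:Z %| g 1%R 0%R)%Z.

(* A function together with the weight with which the operators act on it. *)
Record wform (R : realType) := Wform {
  weight : int;
  wfun : R[i] -> R[i]
}.

(* The nonzero condition of M(N) is implied by leading coefficient 1. *)
Definition in_M (R : realType) (N : nat) (F : wform R) : Prop :=
  let k := weight F in
  let f := wfun F in
  [/\ forall z : R[i], upper_half 0 z -> meromorphic_at f z,
      exists chi : 'M[int]_2 -> R[i], forall g, Gamma0 N g ->
        `|chi g| = 1 /\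
        mero_eq (upper_half 0) (fun tau => f (moebius g tau))
          (fun tau => chi g * autfac g tau ^ k * f tau),
      (* meromorphicity at the cusps; the finite principal part is absorbed in h *)
      forall g, SL2Z g -> exists (w : nat) (h : R) (a : nat -> R[i]),
        (0 < w)%N /\ fourier_expansion w h a (slash k g f) &
      exists (h : R) (a : nat -> int),
        a 0%N = 1 /\ fourier_expansion 1 h (fun n => (a n)%:~R) f].

Definition normalize (R : realType) (f : R[i] -> R[i]) (tau : R[i]) : R[i] :=
  xget 1 [set eps : R[i] | leading_coef (fun t => eps * f t) 1] * f tau.

(* F | T(p^r) at level N.  The weight of the result is the weight of F times the
   number of factors in the product. *)
Definition hecke (R : realType) (N p r : nat) (F : wform R) : wform R :=
  let k := weight F in
  let f := wfun F in
  let K : R := k%:~R in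
  let P : R := p%:R in
  let n := (p ^ r)%N in
  if (p %| N)%N then
    Wform (k * n%:Z)
      (normalize (fun tau =>
        (P `^ (r%:R * K * P ^+ r / 2))%:C *
        \prod_(0 <= j < n) slash k (mx2 1 j%:Z 0 n%:Z) f tau))
  else
    Wform (k * (\sum_(d <- divisors n) d)%N%:Z)
      (normalize (fun tau =>
        (P `^ (K / (1 - P) *
               ((P ^+ r.+1 - P) / (P - 1) - r%:R / 2 * (P ^+ r.+1 + 1))))%:C *
        \prod_(d <- divisors n) \prod_(0 <= b < d)
          slash k (mx2 (n %/ d)%N%:Z b%:Z 0 d%:Z) f tau)).

(* Main.v *)
(* Both composites are, up to nonzero constants, products of translates of f.
   Since f(z + 1) is proportional to f(z), the factor f((n/d z + c) / (d q)) with
   n = l^s, q = p^r depends up to a constant only on c mod d q.  For each divisor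
   d of n, c runs over the numbers b + d j on one side and (n/d) j + b q on the
   other, where b < d, j < q; as n/d is prime to q, both are complete residue
   systems mod d q.  So the two composites are proportional.  The normalizations
   then make them equal: leading coefficients are unique (compare growth as
   Im z -> oo), and functions having one are closed under products (Cauchy
   product of the Fourier series) and under z |-> (a z + b) / d. *)
Require Import Defs.
From mathcomp Require Import all_boot all_order all_algebra complex.
From mathcomp Require Import all_classical all_reals all_analysis.
From mathcomp Require Import ring lra zify.

Set Implicit Arguments.
Unset Strict Implicit.
Unset Printing Implicit Defensive.

Import Order.TTheory GRing.Theory Num.Theory.
Import numFieldNormedType.Exports.
Import ComplexField.Normc.

Local Open Scope classical_set_scope.
Local Open Scope ring_scope.
Local Open Scope complex_scope.

(** * Modulus and limits in the complex numbers *)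

Lemma normcE (R : realType) (z : R[i]) : `|z| = (normc z)%:C.
Proof. by case: z => x y; rewrite normc_def. Qed.

Lemma normc_ge0 (R : realType) (z : R[i]) : 0 <= normc z.
Proof. by case: z => x y; exact: sqrtr_ge0. Qed.

Lemma normcD (R : realType) (y z : R[i]) : normc (y + z) <= normc y + normc z.
Proof. by rewrite -lecR rmorphD -!normcE ler_normD. Qed.

Lemma normcX (R : realType) (z : R[i]) n : normc (z ^+ n) = normc z ^+ n.
Proof. by apply/complexI; rewrite -normcE normrX rmorphXn. Qed.

Lemma normc_real (R : realType) (x : R) : normc x%:C = `|x|.
Proof. by rewrite /normc /= expr0n /= addr0 sqrtr_sqr. Qed.

Lemma normc_gt0 (R : realType) (z : R[i]) : (0 < normc z) = (z != 0).
Proof. by rewrite -ltcR -normcE normr_gt0. Qed.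

Lemma normc_sum (R : realType) I (r : seq I) (P : pred I) (F : I -> R[i]) :
  normc (\sum_(i <- r | P i) F i) <= \sum_(i <- r | P i) normc (F i).
Proof.
elim/big_ind2: _ => [|x1 x2 y1 y2 h1 h2|//]; first by rewrite normc0.
exact: le_trans (normcD _ _) (lerD h1 h2).
Qed.

(** The topology of [R[i]^o] measures distances in [R[i]]; a positive element of [R[i]] is real, so
    real tolerances suffice. *)
Lemma cvgcP (R : realType) (u : nat -> R[i]) (l : R[i]) :
  ((u : nat -> R[i]^o) @ \oo --> (l : R[i]^o)) <->
  forall e : R, 0 < e -> exists N, forall n, (N <= n)%N -> normc (u n - l) < e.
Proof.
split=> [/cvgrPdistC_lt ul e e0|h].
  have /ul[N _ hN] : 0 < e%:C by rewrite ltcR.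
  by exists N => n /hN; rewrite normcE ltcR.
apply/cvgrPdistC_lt => e e0; have eE : e = (complex.Re e)%:C.
  by rewrite RRe_real// gtr0_real.
have [|N hN] := h (complex.Re e); first by rewrite -ltcR -eE.
by exists N => // n /hN; rewrite -ltcR -eE.
Qed.

Lemma eq_cvgc (R : realType) (u v : nat -> R[i]) (l : R[i]) : u =1 v ->
  ((u : nat -> R[i]^o) @ \oo --> (l : R[i]^o)) ->
  (v : nat -> R[i]^o) @ \oo --> (l : R[i]^o).
Proof. by move=> /funext ->. Qed.

Lemma cvgcB (R : realType) (u v : nat -> R[i]) (l m : R[i]) :
  ((u : nat -> R[i]^o) @ \oo --> (l : R[i]^o)) ->
  ((v : nat -> R[i]^o) @ \oo --> (m : R[i]^o)) ->
  (fun n => u n - v n : R[i]^o) @ \oo --> (l - m : R[i]^o).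
Proof. exact: cvgB. Qed.

Lemma cvgcM (R : realType) (u v : nat -> R[i]) (l m : R[i]) :
  ((u : nat -> R[i]^o) @ \oo --> (l : R[i]^o)) ->
  ((v : nat -> R[i]^o) @ \oo --> (m : R[i]^o)) ->
  (fun n => u n * v n : R[i]^o) @ \oo --> (l * m : R[i]^o).
Proof. exact: cvgM. Qed.

Lemma cvgcZ (R : realType) (u : nat -> R[i]) (l c : R[i]) :
  ((u : nat -> R[i]^o) @ \oo --> (l : R[i]^o)) ->
  (fun n => c * u n : R[i]^o) @ \oo --> (c * l : R[i]^o).
Proof. by apply: cvgcM; exact: cvg_cst. Qed.

Lemma cvgc_unique (R : realType) (u : nat -> R[i]) (l m : R[i]) :
  ((u : nat -> R[i]^o) @ \oo --> (l : R[i]^o)) ->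
  ((u : nat -> R[i]^o) @ \oo --> (m : R[i]^o)) -> l = m.
Proof. by apply: cvg_unique; exact: norm_hausdorff. Qed.

Lemma near_dnbhs_complexP (R : realType) (z : R[i]) (P : R[i] -> Prop) :
  (\forall w \near (z : R[i]^o)^', P w) <->
  exists2 e : R, 0 < e & forall w, w != z -> normc (w - z) < e -> P w.
Proof.
split=> [zP|[e e0 h]].
  have /nbhs_normP[e /= e0 h] : \forall w \near (z : R[i]^o), w != z -> P w := zP.
  have eE : e = (complex.Re e)%:C.
    by rewrite RRe_real// gtr0_real.
  exists (complex.Re e) => [|w wz we]; first by rewrite -ltcR -eE.
  by apply: (h w) => //=; rewrite distrC normcE eE ltcR.
suff : \forall w \near (z : R[i]^o), w != z -> P w by [].
apply/nbhs_normP; exists e%:C; first by rewrite /= ltcR.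
by move=> w /= we wz; apply: h => //; rewrite -ltcR -normcE distrC.
Qed.

(** * Power series: absolute bounds, Cauchy products, substitution of powers *)

(** Absolute convergence at radius [rho], stated through partial sums so that an explicit [C] is
    available for estimates. *)
Definition sum_normc_bounded (R : realType) (a : nat -> R[i]) (rho C : R) :=
  forall N, \sum_(i < N) normc (a i) * rho ^+ i <= C.

Lemma geometric_sum_le (R : realType) (t : R) N : 0 <= t -> t < 1 ->
  \sum_(i < N) t ^+ i <= (1 - t)^-1.
Proof.
move=> t0 t1; have h : 0 < 1 - t by rewrite subr_gt0.
rewrite -[leRHS]mul1r ler_pdivlMr// mulrC -opprB mulNr -subrX1 opprB.
by rewrite gerBl exprn_ge0.
Qed.

(** Abel's lemma: convergence at [y] bounds the terms there, and at the smaller radius [rho] they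
    are dominated by a geometric series of ratio [rho / normc y]. *)
Lemma psum_sum_normc_bounded (R : realType) (a : nat -> R[i]) (y s : R[i]) rho :
  (series (fun n => a n * y ^+ n : R[i]^o) @ \oo --> (s : R[i]^o)) ->
  0 <= rho -> rho < normc y -> exists C, sum_normc_bounded a rho C.
Proof.
move=> cvs rho0 rhoy.
have y0 : 0 < normc y by apply: le_lt_trans rhoy.
have /cvg_series_cvg_0/cvgcP/(_ 1 ltr01)[N hN] :
  cvgn (series (fun n => a n * y ^+ n : R[i]^o)) by apply/cvg_ex; exists s.
(* [M] bounds every term at [y]: from [N] on the terms are below 1, and each earlier one is a
   summand of the finite sum. *)
pose M := 1 + \sum_(i < N) normc (a i * y ^+ i).
have hM n : normc (a n) * normc y ^+ n <= M.
  rewrite -normcX -normcM; have [nN|/hN] := ltnP n N; last first.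
    rewrite subr0 => /ltW /le_trans; apply.
    by rewrite lerDl sumr_ge0// => i _; exact: normc_ge0.
  rewrite /M (bigD1 (Ordinal nN))//= addrCA lerDl.
  by rewrite addr_ge0 ?ler01// sumr_ge0// => i _; exact: normc_ge0.
exists (M * (1 - rho / normc y)^-1) => n.
have M0 : 0 <= M by apply: le_trans (hM 0%N); rewrite mulr_ge0 ?exprn_ge0 ?normc_ge0.
apply: (@le_trans _ _ (\sum_(i < n) M * (rho / normc y) ^+ i)).
  apply: ler_sum => i _; rewrite expr_div_n mulrA ler_pdivlMr ?exprn_gt0//.
  by rewrite mulrAC ler_wpM2r ?exprn_ge0.
rewrite -mulr_sumr ler_wpM2l// geometric_sum_le//.
  by rewrite divr_ge0// ltW.
by rewrite ltr_pdivrMr// mul1r.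
Qed.

Lemma sum_normc_bounded_ge0 (R : realType) (a : nat -> R[i]) (rho C : R) :
  sum_normc_bounded a rho C -> 0 <= C.
Proof. by move=> /(_ 0%N); rewrite big_ord0. Qed.

(** Every term after the first contains a factor [x], so replacing the other factors [x] by [rho]
    gains [normc x / rho] on the bound [C]. *)
Lemma psum_dist_head (R : realType) (a : nat -> R[i]) (x s : R[i]) rho C :
  sum_normc_bounded a rho C -> normc x <= rho -> 0 < rho ->
  (series (fun n => a n * x ^+ n : R[i]^o) @ \oo --> (s : R[i]^o)) ->
  normc (s - a 0%N) <= C * (normc x / rho).
Proof.
move=> hC xr r0 /cvgcP hs; apply/ler_addgt0Pr => e /hs[N /(_ N.+1 (leqnSn N))].
rewrite seriesEord/= big_ord_recl expr0 mulr1 => h.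
set T := \sum_(i < N) _ in h.
have hT : normc T <= C * (normc x / rho).
  apply: (le_trans (normc_sum _ _ _)).
  apply: (@le_trans _ _ (\sum_(i < N) normc (a i.+1) * rho ^+ i.+1 * (normc x / rho))).
    apply: ler_sum => i _; rewrite normcM normcX -mulrA ler_wpM2l ?normc_ge0//.
    rewrite !exprS [leRHS](_ : _ = normc x * rho ^+ i); last first.
      by rewrite [rho * _]mulrC mulrACA divff ?gt_eqF// mulr1 mulrC.
    by rewrite ler_wpM2l ?normc_ge0// lerXn2r ?nnegrE ?normc_ge0// ltW.
  rewrite -mulr_suml; apply: ler_wpM2r; first by rewrite divr_ge0 ?normc_ge0// ltW.
  apply: (le_trans _ (hC N.+1)); rewrite big_ord_recl /= lerDr.
  by rewrite expr0 mulr1 normc_ge0.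
have -> : s - a 0%N = T - (a 0%N + T - s) by ring.
by apply: (le_trans (normcD _ _)); rewrite normcN lerD// ltW.
Qed.

Definition conv (R : realType) (a b : nat -> R[i]) (n : nat) : R[i] :=
  \sum_(i < n.+1) a i * b (n - i)%N.

(** Both sides run over the triangle [i + j < N], by antidiagonals and by rows; the induction adds
    the antidiagonal [i + j = N] at the end of the rows. *)
Lemma sum_antidiagonal (V : zmodType) (F : nat -> nat -> V) N :
  \sum_(0 <= n < N) \sum_(0 <= i < n.+1) F i (n - i)%N =
  \sum_(0 <= i < N) \sum_(0 <= j < N - i) F i j.
Proof.
elim: N => [|N IH]; first by rewrite !big_geq.
rewrite big_nat_recr//= IH; under [RHS]eq_big_nat => i /andP[_ iN].
  by rewrite subSn// big_nat_recr//=; over.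
rewrite big_split/= [in RHS]big_nat_recr//= subnn. by rewrite [X in _ + X + _]big_geq ?addr0.
Qed.

(** The product of the partial sums exceeds the partial sum of the Cauchy product by the terms of
    the square with [i + j >= N]. With [u = normc x / rho < 1], these total at most
    [C * D * u ^+ N], which tends to 0. *)
Lemma psum_conv (R : realType) (a b : nat -> R[i]) (x s t : R[i]) rho C D :
  sum_normc_bounded a rho C -> sum_normc_bounded b rho D -> normc x < rho ->
  (series (fun n => a n * x ^+ n : R[i]^o) @ \oo --> (s : R[i]^o)) ->
  (series (fun n => b n * x ^+ n : R[i]^o) @ \oo --> (t : R[i]^o)) ->
  (series (fun n => conv a b n * x ^+ n : R[i]^o) @ \oo --> (s * t : R[i]^o)).
Proof.
move=> hC hD xr hs ht.
have r0 : 0 < rho by apply: le_lt_trans xr; exact: normc_ge0.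
pose F i j := (a i * x ^+ i) * (b j * x ^+ j).
have E N : series (fun n => a n * x ^+ n) N * series (fun n => b n * x ^+ n) N -
    series (fun n => conv a b n * x ^+ n) N =
    \sum_(0 <= i < N) \sum_(N - i <= j < N) F i j.
  rewrite /series/= big_distrlr/=.
  have -> : \sum_(0 <= n < N) conv a b n * x ^+ n =
     \sum_(0 <= n < N) \sum_(0 <= i < n.+1) F i (n - i)%N.
    apply: eq_bigr => n _; rewrite /conv mulr_suml big_mkord.
    apply: eq_bigr => i _; rewrite /F mulrACA -exprD subnKC//.
    by rewrite -ltnS.
  rewrite sum_antidiagonal -sumrB; apply: eq_big_nat => i /andP[_ iN].
  rewrite (@big_cat_nat _ _ _ (N - i)) ?leq_subr//=. by rewrite addrAC /F subrr add0r.
set u := normc x / rho; have u0 : 0 <= u by rewrite divr_ge0 ?normc_ge0 ?ltW.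
have u1 : u < 1 by rewrite ltr_pdivrMr// mul1r.
have B N : normc (\sum_(0 <= i < N) \sum_(N - i <= j < N) F i j) <= C * D * u ^+ N.
  pose G i j := normc (a i) * rho ^+ i * (normc (b j) * rho ^+ j).
  have G0 i j : 0 <= G i j by rewrite !mulr_ge0 ?normc_ge0 ?exprn_ge0// ltW.
  have FG i j : (N <= i + j)%N -> normc (F i j) <= G i j * u ^+ N.
    move=> ij; have -> : normc (F i j) = G i j * u ^+ (i + j).
      rewrite /F /G !normcM !normcX /u exprD !expr_div_n.
      by field; rewrite !expf_neq0 ?gt_eqF.
    by rewrite ler_wpM2l// ler_wiXn2l// ltW.
  apply: (le_trans (normc_sum _ _ _)).
  apply: (@le_trans _ _ (\sum_(0 <= i < N) \sum_(0 <= j < N) G i j * u ^+ N)).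
    rewrite big_nat [leRHS]big_nat; apply: ler_sum => i /andP[_ iN].
    apply: (le_trans (normc_sum _ _ _)).
    (* The row is completed to all [j < N]; the added majorants are nonnegative. *)
    rewrite [leRHS](@big_cat_nat _ _ _ (N - i)) ?leq_subr//=.
    rewrite -[leLHS]add0r lerD ?sumr_ge0// => [j _|].
      by rewrite mulr_ge0 ?exprn_ge0.
    rewrite big_nat [leRHS]big_nat; apply: ler_sum => j /andP[ij _].
    by apply: FG; lia.
  under eq_bigr do rewrite -mulr_suml -mulr_sumr.
  rewrite -!mulr_suml !big_mkord ler_wpM2r ?exprn_ge0// ler_pM ?hC ?hD//.
    by apply: sumr_ge0 => i _; rewrite mulr_ge0 ?normc_ge0 ?exprn_ge0 ?ltW.
  by apply: sumr_ge0 => i _; rewrite mulr_ge0 ?normc_ge0 ?exprn_ge0 ?ltW.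
have Z : (fun N => \sum_(0 <= i < N) \sum_(N - i <= j < N) F i j : R[i]^o) @ \oo --> (0 : R[i]^o).
  apply/cvgcP => e e0; have : (fun n => C * D * u ^+ n) @ \oo --> (0 : R).
    by apply: cvg_geometric; rewrite ger0_norm.
  move=> /cvgrPdist_lt/(_ _ e0)[N _ hN]; exists N => n /hN.
  rewrite sub0r normrN subr0 => h; apply: le_lt_trans h.
  exact: le_trans (B n) (ler_norm _).
have := cvgcB (cvgcM hs ht) Z; rewrite subr0; apply: eq_cvgc => N.
by rewrite -[in LHS](E N) /= opprB addrC subrK.
Qed.

(** Coefficients after substituting [x ^+ m] for the variable. This serves both to reach a common
    width of two Fourier expansions and to rescale the argument by an integer. *)
Definition spread (R : realType) (m : nat) (a : nat -> R[i]) (n : nat) : R[i] :=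
  if (m %| n)%N then a (n %/ m)%N else 0.

Lemma psum_spread (R : realType) (a : nat -> R[i]) (x s : R[i]) m : (0 < m)%N ->
  (series (fun n => a n * (x ^+ m) ^+ n : R[i]^o) @ \oo --> (s : R[i]^o)) ->
  (series (fun n => spread m a n * x ^+ n : R[i]^o) @ \oo --> (s : R[i]^o)).
Proof.
move=> m0 /cvgcP hs; apply/cvgcP => e /hs[N hN]; exists (N * m)%N => n hn.
(* [(n + m.-1) %/ m] is [n / m] rounded up, the number of multiples of [m] below [n]. *)
suff -> : series (fun n => spread m a n * x ^+ n) n =
    series (fun n => a n * (x ^+ m) ^+ n) ((n + m.-1) %/ m)%N.
  by apply: hN; rewrite leq_divRL//; lia.
elim: n {hn} => [|n IH].
  by rewrite add0n divn_small ?prednK// /series/= !big_geq.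
rewrite /series/= big_nat_recr//=; rewrite /series/= in IH; rewrite IH /spread.
have [/dvdnP[k ->]|ndv] := boolP (m %| n)%N.
  rewrite mulnK// divnMDl// divn_small ?addn0 ?prednK//.
  by rewrite addSnnS prednK// -mulSnr mulnK// big_nat_recr//= -exprM mulnC.
(* When [m] does not divide [n], rounding up [n / m] and [(n + 1) / m] gives the same integer. *)
rewrite mul0r addr0; congr (\sum_(0 <= i < _) _).
have r0 : (0 < n %% m)%N by rewrite lt0n; exact: ndv.
have rm := ltn_pmod n m0.
rewrite (divn_eq n m) addSn -!addnA -addnS !divnMDl//; congr addn.
have -> : (n %% m + m.-1 = 1 * m + (n %% m).-1)%N by lia.
have -> : ((1 * m + (n %% m).-1).+1 = 1 * m + n %% m)%N by lia.
by rewrite !divnMDl// !divn_small//; lia.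
Qed.

(** * Equality of meromorphic functions *)

Section MeroEq.
Variable R : realType.
Implicit Types (U V : set R[i]) (f g : R[i] -> R[i]) (h k : R).

Lemma mero_eq_ext U f g : (forall z, f z = g z) -> mero_eq U f g.
Proof. by move=> fg z _; apply/near_dnbhs_complexP; exists 1. Qed.

Lemma mero_eq_sym U f g : mero_eq U f g -> mero_eq U g f.
Proof. by move=> fg z /fg; apply: filterS. Qed.

Lemma mero_eq_trans U f g (h : R[i] -> R[i]) : mero_eq U f g -> mero_eq U g h -> mero_eq U f h.
Proof. by move=> fg gh z Uz; apply: filterS2 (fg z Uz) (gh z Uz) => w -> ->. Qed.

Lemma mero_eq_sub U V f g : V `<=` U -> mero_eq U f g -> mero_eq V f g.
Proof. by move=> VU fg z /VU; exact: fg. Qed.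

Lemma mero_eqM U f g f' g' : mero_eq U f f' -> mero_eq U g g' ->
  mero_eq U (fun z => f z * g z) (fun z => f' z * g' z).
Proof. by move=> ff gg z Uz; apply: filterS2 (ff z Uz) (gg z Uz) => w -> ->. Qed.

Lemma mero_eqZ U (c : R[i]) f g : mero_eq U f g ->
  mero_eq U (fun z => c * f z) (fun z => c * g z).
Proof. by move=> fg z /fg; apply: filterS => w ->. Qed.

Lemma mero_eq_comp_affine U V f g (c e : R[i]) : c != 0 ->
  (forall z, V z -> U (c * z + e)) -> mero_eq U f g ->
  mero_eq V (fun z => f (c * z + e)) (fun z => g (c * z + e)).
Proof.
move=> c0 VU fg z /VU/fg/near_dnbhs_complexP[r r0 h].
have nc0 : 0 < normc c by rewrite normc_gt0.
apply/near_dnbhs_complexP; exists (r / normc c) => [|w wz]; first by rewrite divr_gt0.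
have E : c * w + e - (c * z + e) = c * (w - z) by ring.
rewrite ltr_pdivlMr// mulrC -normcM => hw; apply: h; last by rewrite E.
by rewrite -subr_eq0 E mulf_neq0// subr_eq0.
Qed.

(** * The exponential e(z) *)

Lemma cexpD (x y : R[i]) : cexp (x + y) = cexp x * cexp y.
Proof.
case: x y => [a b] [c d]; rewrite /cexp/= expRD cosD sinD rmorphM.
by rewrite mulrACA; congr (_ * _); apply/eqP; rewrite eq_complex /= !eqxx addrC mulrC /= eq_sym.
Qed.

Lemma e2piD (x y : R[i]) : e2pi (x + y) = e2pi x * e2pi y.
Proof. by rewrite /e2pi mulrDr cexpD. Qed.

Lemma e2pi0 : e2pi 0 = 1 :> R[i].
Proof. by rewrite /e2pi mulr0 /cexp/= expR0 cos0 sin0 mul1r. Qed.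

Lemma e2piMn n (z : R[i]) : e2pi (n%:R * z) = e2pi z ^+ n.
Proof.
elim: n => [|n IH]; first by rewrite mul0r e2pi0.
by rewrite -natr1 mulrDl mul1r e2piD IH exprSr.
Qed.

Lemma normc_e2pi (z : R[i]) : normc (e2pi z) = expR (- (2 * pi * complex.Im z)).
Proof.
case: z => x y; rewrite /e2pi /cexp normcM normc_real ger0_norm ?expR_ge0//=.
rewrite cos2Dsin2 sqrtr1 mulr1; congr expR.
by ring.
Qed.

Lemma e2pi_neq0 (z : R[i]) : e2pi z != 0.
Proof. by rewrite -normc_gt0 normc_e2pi expR_gt0. Qed.

Lemma Im_divn (z : R[i]) n : complex.Im (z / n%:R) = complex.Im z / n%:R.
Proof.
have -> : (n%:R : R[i])^-1 = (n%:R^-1)%:C by rewrite fmorphV rmorph_nat.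
by case: z => x y /=; ring.
Qed.

(** * Fourier expansions *)

(** Turns a Fourier series of width [w] into a power series in e(tau / w), to which the preceding
    estimates apply. *)
Lemma fourier_termE w (a : nat -> R[i]) tau :
  (fun n => a n * e2pi (n%:R / w%:R * tau)) =
  (fun n => a n * e2pi (tau / w%:R) ^+ n).
Proof. by apply/funext => n; rewrite -e2piMn mulrAC -mulrA. Qed.

Lemma fourier_sum_normc_bounded w (a : nat -> R[i]) g (A B : R) : (0 < w)%N ->
  (forall tau, upper_half A tau ->
    series (fun n => a n * e2pi (n%:R / w%:R * tau) : R[i]^o) @ \oo --> (g tau : R[i]^o)) ->
  A < B -> exists C, sum_normc_bounded a (expR (- (2 * pi * (B / w%:R)))) C.
Proof.
move=> w0 hg AB; have w0' : 0 < w%:R :> R by rewrite ltr0n.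
(* A height strictly between [A] and [B]: the series converges at [t], and e(t / w) has modulus
   larger than the radius attached to [B]. *)
pose t := Complex 0 ((A + B) / 2); have /hg : upper_half A t by rewrite /upper_half/=; lra.
rewrite fourier_termE => /psum_sum_normc_bounded; apply; first exact: expR_ge0.
rewrite normc_e2pi ltr_expR ltrN2 ltr_pM2l ?mulr_gt0 ?pi_gt0//.
by rewrite Im_divn /= ltr_pM2r ?invr_gt0//; lra.
Qed.

Lemma fourier_expansion_mero_eq w h (a : nat -> R[i]) f g :
  mero_eq (upper_half 0) f g -> fourier_expansion w h a f -> fourier_expansion w h a g.
Proof.
move=> fg [A [G [A0 hG fG]]]; exists A, G; split => //.
apply: mero_eq_trans fG; apply: mero_eq_sym; apply: mero_eq_sub fg => z.
exact: le_lt_trans.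
Qed.

Lemma fourier_expansionZ w h (a : nat -> R[i]) f (c : R[i]) :
  fourier_expansion w h a f ->
  fourier_expansion w h (fun n => c * a n) (fun z => c * f z).
Proof.
move=> [A [G [A0 hG fG]]]; exists A, (fun z => c * G z); split; first exact: A0.
  move=> t /hG ht; have := cvgcZ (c := c) ht; apply: eq_cvgc => N.
  rewrite /series/= mulr_sumr.
  by apply: eq_bigr => i _; rewrite mulrA.
apply: mero_eq_trans (mero_eqZ _ fG) _.
by apply: mero_eq_ext => z; rewrite mulrCA.
Qed.

Lemma fourier_expansionM w h k (a b : nat -> R[i]) f g : (0 < w)%N ->
  fourier_expansion w h a f -> fourier_expansion w k b g ->
  fourier_expansion w (h + k) (conv a b) (fun z => f z * g z).
Proof.
move=> w0 [A [F [A0 hF fF]]] [B [G [B0 hG gG]]].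
exists (Num.max A B), (fun z => F z * G z); split.
- by rewrite le_max A0.
- move=> t; rewrite /upper_half/= gt_max => /andP[At Bt].
  have w0' : 0 < w%:R :> R by rewrite ltr0n.
  set M := Num.max A B; have tM : M < complex.Im t by rewrite gt_max At.
  (* The height [m] lies below [t], so its radius exceeds the modulus of e(t / w), yet above [A] and
     [B], so both series are absolutely bounded there. *)
  pose m := (M + complex.Im t) / 2.
  have Am : A < m by have : A <= M by [rewrite le_max lexx|]; rewrite /m; lra.
  have Bm : B < m by have : B <= M by [rewrite le_max lexx orbT|]; rewrite /m; lra.
  have [C hC] := fourier_sum_normc_bounded w0 hF Am.
  have [D hD] := fourier_sum_normc_bounded w0 hG Bm.
  move: (hF _ At) (hG _ Bt); rewrite !fourier_termE; apply: psum_conv hC hD _.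
  rewrite normc_e2pi ltr_expR ltrN2 ltr_pM2l ?mulr_gt0 ?pi_gt0//.
  by rewrite Im_divn ltr_pM2r ?invr_gt0// /m; lra.
apply: mero_eq_trans (mero_eqM (mero_eq_sub _ fF) (mero_eq_sub _ gG)) _.
- by move=> t; rewrite /upper_half/= gt_max => /andP[].
- by move=> t; rewrite /upper_half/= gt_max => /andP[].
by apply: mero_eq_ext => z; rewrite rmorphD mulrDl e2piD mulrACA.
Qed.

Lemma fourier_expansion_spread w h (a : nat -> R[i]) f m : (0 < m)%N ->
  fourier_expansion w h a f -> fourier_expansion (w * m) h (spread m a) f.
Proof.
move=> m0 [A [F [A0 hF fF]]]; exists A, F; split => // t /hF.
rewrite !fourier_termE => ht; apply: psum_spread => //.
rewrite -e2piMn [m%:R * _](_ : _ = t / w%:R)//.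
rewrite natrM invfM [LHS](_ : _ = t / w%:R * (m%:R / m%:R)); last by ring.
by rewrite divff ?mulr1// pnatr_eq0 -lt0n.
Qed.

Lemma Im_affine a b d (z : R[i]) :
  complex.Im (a%:R / d%:R * z + b%:R / d%:R) = complex.Im z * (a%:R / d%:R).
Proof.
rewrite mulrAC -mulrDl Im_divn mulrA; congr (_ / _).
have -> : (a%:R : R[i]) = a%:R%:C by rewrite rmorph_nat.
have -> : (b%:R : R[i]) = b%:R%:C by rewrite rmorph_nat.
by case: z => x y /=; ring.
Qed.

(** At (a z + b) / d, the power q^(n/w) becomes a root of unity, the [n]-th power of e(b / (d w)),
    times q^(n a / (w d)); hence the twist, the spreading by [a] and the width [w * d]. The
    prefactor q^h contributes the constant e(h b / d). *)
Lemma fourier_expansion_affine w h (al : nat -> R[i]) f a b d :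
  (0 < a)%N -> (0 < d)%N -> fourier_expansion w h al f ->
  fourier_expansion (w * d) (h * (a%:R / d%:R))
    (fun n => e2pi (h%:C * (b%:R / d%:R)) *
       spread a (fun n => al n * e2pi (b%:R / d%:R / w%:R) ^+ n) n)
    (fun z => f (a%:R / d%:R * z + b%:R / d%:R)).
Proof.
move=> a0 d0 [A [F [A0 hF fF]]].
have d0' : 0 < d%:R :> R by rewrite ltr0n.
have a0' : 0 < a%:R :> R by rewrite ltr0n.
have UU z : upper_half (A * d%:R / a%:R) z -> upper_half A (a%:R / d%:R * z + b%:R / d%:R).
  rewrite /upper_half/= Im_affine ltr_pdivrMr// mulrA ltr_pdivlMr//.
exists (A * d%:R / a%:R),
  (fun z => e2pi (h%:C * (b%:R / d%:R)) * F (a%:R / d%:R * z + b%:R / d%:R)); split.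
- by rewrite divr_ge0// ?mulr_ge0// ltW.
- move=> t /UU/hF; rewrite !fourier_termE => ht.
  have {}ht : series (fun n => spread a (fun n => al n * e2pi (b%:R / d%:R / w%:R) ^+ n) n *
      e2pi (t / (w * d)%N%:R) ^+ n : R[i]^o) @ \oo
      --> (F (a%:R / d%:R * t + b%:R / d%:R) : R[i]^o).
    apply: psum_spread => //; move: ht; apply: eq_cvgc => N; apply: eq_bigr => n _.
    rewrite -[RHS]mulrA -exprMn; congr (_ * _ ^+ _).
    by rewrite -e2piMn -e2piD natrM invfM; congr e2pi; ring.
  have := cvgcZ (c := e2pi (h%:C * (b%:R / d%:R))) ht; apply: eq_cvgc => N.
  rewrite /series/= mulr_sumr.
  by apply: eq_bigr => i _; rewrite mulrA.
apply: mero_eq_trans (mero_eq_comp_affine _ UU fF) _.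
  by rewrite mulf_neq0 ?invr_eq0 ?pnatr_eq0; lia.
apply: mero_eq_ext => z; rewrite mulrA -e2piD; congr (e2pi _ * _).
by rewrite !rmorphM fmorphV !rmorph_nat; ring.
Qed.

(** e(t / w) tends to 0 as the imaginary part grows, and the distance to the constant term is at
    most a multiple of its modulus. *)
Lemma fourier_sum_at_infinity w (a : nat -> R[i]) g (A : R) : (0 < w)%N ->
  (forall tau, upper_half A tau ->
    series (fun n => a n * e2pi (n%:R / w%:R * tau) : R[i]^o) @ \oo --> (g tau : R[i]^o)) ->
  forall e, 0 < e -> exists B, forall t, B < complex.Im t -> normc (g t - a 0%N) < e.
Proof.
move=> w0 hg e e0; have w0' : 0 < w%:R :> R by rewrite ltr0n.
have [|C hC] := fourier_sum_normc_bounded w0 hg (_ : A < A + 1); first by rewrite ltrDl.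
set rho := expR _ in hC; have r0 : 0 < rho by exact: expR_gt0.
have C0 := sum_normc_bounded_ge0 hC.
(* The denominator is [C + 1] because [C] may be 0. *)
have de : 0 < e * rho / (C + 1) by rewrite divr_gt0 ?mulr_gt0// ltr_wpDl.
(* The first bound keeps e(t / w) within radius [rho]; the second solves for its modulus being below
   [e * rho / (C + 1)]. *)
exists (Num.max (A + 1) (- ln (e * rho / (C + 1)) * w%:R / (2 * pi))) => t.
rewrite gt_max => /andP[At Bt].
have /hg : upper_half A t by rewrite /upper_half/=; lra.
rewrite fourier_termE => /(psum_dist_head hC) h.
have p0 : 0 < 2 * pi :> R by rewrite mulr_gt0 ?pi_gt0.
have x1 : normc (e2pi (t / w%:R)) < e * rho / (C + 1).
  rewrite normc_e2pi -[ltRHS]lnK// ltr_expR Im_divn ltrNl.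
  by rewrite mulrA ltr_pdivlMr// [ltRHS]mulrC -ltr_pdivrMr//.
apply: le_lt_trans (h _ r0) _.
  rewrite normc_e2pi ler_expR lerN2 ler_pM2l// Im_divn.
  by rewrite ler_pM2r ?invr_gt0// ltW.
rewrite mulrA ltr_pdivrMr//; move: x1; rewrite ltr_pdivlMr; last by rewrite ltr_wpDl.
apply: le_lt_trans; rewrite mulrC ler_wpM2l ?normc_ge0//; lra.
Qed.

End MeroEq.

(** * Leading coefficients, normalization and proportionality *)

Section LeadingCoef.
Variable R : realType.
Implicit Types (f g : R[i] -> R[i]) (c x : R[i]).

Lemma leading_coef_mero_eq f g c :
  mero_eq (upper_half 0) f g -> leading_coef f c -> leading_coef g c.
Proof.
move=> fg [c0 [w [h [a [w0 a0 fa]]]]]; split=> //; exists w, h, a; split => //.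
exact: fourier_expansion_mero_eq fg fa.
Qed.

Lemma leading_coefZ f c x : x != 0 ->
  leading_coef f c -> leading_coef (fun t => x * f t) (x * c).
Proof.
move=> x0 [c0 [w [h [a [w0 a0 fa]]]]]; split; first exact: mulf_neq0.
exists w, h, (fun n => x * a n); split => //; first by rewrite a0.
exact: fourier_expansionZ.
Qed.

(** Spreading brings the widths [w] and [v] to the common width [w * v]; the Cauchy product then has
    [c * d] as coefficient 0. *)
Lemma leading_coefM f g c d : leading_coef f c -> leading_coef g d ->
  leading_coef (fun t => f t * g t) (c * d).
Proof.
move=> [c0 [w [h [a [w0 a0 fa]]]]] [d0 [v [k [b [v0 b0 gb]]]]].
split; first exact: mulf_neq0.
exists (w * v)%N, (h + k), (conv (spread v a) (spread w b)); split.
- by rewrite muln_gt0 w0.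
- by rewrite /conv big_ord1 /spread !dvdn0 !div0n a0 b0.
apply: fourier_expansionM; first by rewrite muln_gt0 w0.
  exact: fourier_expansion_spread.
by rewrite mulnC; exact: fourier_expansion_spread.
Qed.

Lemma leading_coef1 : leading_coef (fun=> 1 : R[i]) 1.
Proof.
split; first exact: oner_neq0.
exists 1%N, 0, (fun n => (n == 0%N)%:R); split => //.
exists 0, (fun=> 1); split => //.
  move=> t _; apply/cvgcP => e e0; exists 1%N => -[//|n] _.
  rewrite /series/= big_nat_recl//= big1 ?addr0 => [|i _]; last by rewrite mul0r.
  by rewrite !mul0r e2pi0 mulr1 subrr normc0.
by apply: mero_eq_ext => z; rewrite mul0r e2pi0 mulr1.
Qed.

Lemma leading_coef_affine f c a b d : (0 < a)%N -> (0 < d)%N ->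
  leading_coef f c ->
  exists c', leading_coef (fun t => f (a%:R / d%:R * t + b%:R / d%:R)) c'.
Proof.
move=> a0 d0 [c0 [w [h [al [w0 al0 fal]]]]].
exists (e2pi (h%:C * (b%:R / d%:R)) * c); split.
  by rewrite mulf_neq0 ?e2pi_neq0.
have := fourier_expansion_affine b a0 d0 fal; set a' := (X in fourier_expansion _ _ X).
move=> H; exists (w * d)%N, (h * (a%:R / d%:R)), a'; split => //.
  by rewrite muln_gt0 w0.
by rewrite /a' /spread dvdn0 div0n expr0 mulr1 al0.
Qed.

Lemma cvgc_at_infinity g (l : R[i]) (t : nat -> R[i]) :
  (forall e : R, 0 < e -> exists B, forall z, B < complex.Im z -> normc (g z - l) < e) ->
  (forall n, n%:R < complex.Im (t n)) ->
  (fun n => g (t n) : R[i]^o) @ \oo --> (l : R[i]^o).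
Proof.
move=> hg ht; apply/cvgcP => e /hg[B hB]; exists (Num.truncn B).+1 => n hn.
apply: hB; apply: lt_trans (ht n); apply: lt_le_trans (truncnS_gt _) _.
by rewrite ler_nat.
Qed.

Lemma e2pi_at_infinity (del : R) : 0 < del ->
  forall e : R, 0 < e ->
  exists B, forall z : R[i], B < complex.Im z -> normc (e2pi (del%:C * z) - 0) < e.
Proof.
move=> d0 e e0; exists (- ln e / (2 * pi * del)) => z.
have p0 : 0 < 2 * pi * del by rewrite !mulr_gt0 ?pi_gt0.
rewrite subr0 normc_e2pi -[X in _ -> _ < X]lnK// ltr_expR ltr_pdivrMr//.
have -> : complex.Im (del%:C * z) = del * complex.Im z by case: z => u v /=; ring.
by rewrite ltrNl mulrC mulrA.
Qed.

(** [mero_eq] controls no prescribed point; this supplies points of arbitrarily large height where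
    the values do agree. *)
Lemma mero_eq_point (A : R) f g : mero_eq (upper_half A) f g ->
  forall B, exists t, B < complex.Im t /\ f t = g t.
Proof.
move=> fg B; pose m := Num.max A B + 1.
have [Am Bm] : A < m /\ B < m.
  by split; apply: le_lt_trans (ltr_pwDr ltr01 (lexx _)); rewrite le_max lexx ?orbT.
have /near_dnbhs_complexP[r r0 h] := fg (Complex 0 m) Am.
(* A horizontal displacement leaves the excluded centre without changing the height. *)
exists (Complex (r / 2) m); split => //; apply: h.
  by rewrite eq_complex/= negb_and gt_eqF// divr_gt0.
have -> : Complex (r / 2) m - Complex 0 m = (r / 2)%:C.
  by apply/eqP; rewrite eq_complex /= subr0 subrr !eqxx.
by rewrite normc_real gtr0_norm ?divr_gt0//; lra.
Qed.

(** Both expansions are compared along points [t n] with imaginary part tending to infinity. There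
    [F] tends to [c] and [G] to [d], both nonzero, while e of a positive multiple of [t n] tends to
    0, which decides between the exponents [h] and [k]. *)
Lemma leading_coefZ_unique f c x d :
  leading_coef f c -> leading_coef (fun t => x * f t) d -> d = x * c.
Proof.
move=> [c0 [w [h [a [w0 a0 [A [F [A0 hF fF]]]]]]]].
move=> [d0 [v [k [b [v0 b0 [B [G [B0 hG gG]]]]]]]].
have E : mero_eq (upper_half (Num.max A B)) (fun t => e2pi (k%:C * t) * G t)
    (fun t => x * (e2pi (h%:C * t) * F t)).
  apply: mero_eq_trans (mero_eq_sym (mero_eq_sub _ gG)) _.
    by move=> t; rewrite /upper_half/= gt_max => /andP[].
  by apply: mero_eqZ; apply: mero_eq_sub fF => t; rewrite /upper_half/= gt_max => /andP[].
have /choice[t ht] n := mero_eq_point E n%:R.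
have {}E n : e2pi (k%:C * t n) * G (t n) = x * (e2pi (h%:C * t n) * F (t n)).
  by case: (ht n).
have {}ht n : n%:R < complex.Im (t n) by case: (ht n).
have cF : (fun n => F (t n) : R[i]^o) @ \oo --> (c : R[i]^o).
  by rewrite -a0; apply: cvgc_at_infinity ht; exact: fourier_sum_at_infinity w0 hF.
have cG : (fun n => G (t n) : R[i]^o) @ \oo --> (d : R[i]^o).
  by rewrite -b0; apply: cvgc_at_infinity ht; exact: fourier_sum_at_infinity v0 hG.
have cxF := cvgcZ (c := x) cF.
have quot (u u' : R) z : e2pi (u%:C * z) = e2pi ((u - u')%:C * z) * e2pi (u'%:C * z).
  by rewrite -e2piD -mulrDl -rmorphD subrK.
have [hk|kh|hk] := ltrgtP h k.
(* For [h < k] the left side tends to 0, so [x * c = 0] and [x = 0]; then [G] vanishes along [t n]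
   and both sides of the claim are 0. *)
- have E' n : e2pi ((k - h)%:C * t n) * G (t n) = x * F (t n).
    apply: (mulfI (e2pi_neq0 (h%:C * t n))).
    by rewrite mulrCA mulrA -quot E; ring.
  have hk' : 0 < k - h by rewrite subr_gt0.
  have := cvgcM (cvgc_at_infinity (e2pi_at_infinity hk') ht) cG.
  move/(eq_cvgc E')/(cvgc_unique cxF); rewrite mul0r => /eqP.
  rewrite mulf_eq0 (negPf c0) orbF => /eqP x0.
  have Z n : G (t n) = 0.
    by apply: (mulfI (e2pi_neq0 (k%:C * t n))); rewrite E x0 mul0r mulr0.
  by rewrite x0 mul0r; apply: cvgc_unique (eq_cvgc Z cG) _; exact: cvg_cst.
(* For [k < h] the limit gives [d = 0], a contradiction. *)
- have E' n : e2pi ((h - k)%:C * t n) * (x * F (t n)) = G (t n).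
    apply: (mulfI (e2pi_neq0 (k%:C * t n))).
    by rewrite mulrCA mulrA [e2pi _ * e2pi _]mulrC E (quot h k); ring.
  have hk' : 0 < h - k by rewrite subr_gt0.
  have := cvgcM (cvgc_at_infinity (e2pi_at_infinity hk') ht) cxF.
  move/(eq_cvgc E')/(cvgc_unique cG); rewrite mul0r => d0'.
  by rewrite d0' eqxx in d0.
apply: cvgc_unique cG _; apply: eq_cvgc cxF => n.
by apply: (mulfI (e2pi_neq0 (k%:C * t n))); rewrite E hk mulrCA.
Qed.

(** By uniqueness the set of normalizing constants is the singleton of [c^-1], so [xget] returns it
    and never its default. *)
Lemma normalizeE f c : leading_coef f c -> normalize f = (fun t => c^-1 * f t).
Proof.
move=> fc; have c0 : c != 0 by case: fc.
apply/funext => t; rewrite /normalize; congr (_ * _); apply: xget_unique => /=.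
  by have := leading_coefZ (invr_neq0 c0) fc; rewrite mulVf.
by move=> x /(leading_coefZ_unique fc) E; apply: (mulIf c0); rewrite -E mulVf.
Qed.

(* Equality of meromorphic functions up to a nonzero constant factor. *)
Definition prop_eq f g :=
  exists2 x, x != 0 & mero_eq (upper_half 0) f (fun t => x * g t).

Lemma mero_eq_prop_eq f g : mero_eq (upper_half 0) f g -> prop_eq f g.
Proof.
move=> fg; exists 1; first exact: oner_neq0.
by apply: mero_eq_trans fg _; apply: mero_eq_ext => z; rewrite mul1r.
Qed.

Lemma prop_eq_ext f g : f =1 g -> prop_eq f g.
Proof. by move=> fg; apply: mero_eq_prop_eq; exact: mero_eq_ext. Qed.

Lemma prop_eq_scale x f : x != 0 -> prop_eq (fun t => x * f t) f.
Proof. by move=> x0; exists x => //; exact: mero_eq_ext. Qed.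

Lemma prop_eq_trans f g (h : R[i] -> R[i]) :
  prop_eq f g -> prop_eq g h -> prop_eq f h.
Proof.
move=> [x x0 fg] [y y0 gh]; exists (x * y); first exact: mulf_neq0.
apply: mero_eq_trans fg (mero_eq_trans (mero_eqZ _ gh) _).
by apply: mero_eq_ext => z; rewrite mulrA.
Qed.

Lemma prop_eq_sym f g : prop_eq f g -> prop_eq g f.
Proof.
move=> [x x0 fg]; exists x^-1; first exact: invr_neq0.
apply: mero_eq_sym.
apply: mero_eq_trans (mero_eqZ _ fg) _.
by apply: mero_eq_ext => z; rewrite mulKf.
Qed.

Lemma prop_eqM f g f' g' : prop_eq f f' -> prop_eq g g' ->
  prop_eq (fun t => f t * g t) (fun t => f' t * g' t).
Proof.
move=> [x x0 ff] [y y0 gg]; exists (x * y); first exact: mulf_neq0.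
apply: mero_eq_trans (mero_eqM ff gg) _.
by apply: mero_eq_ext => z; rewrite mulrACA.
Qed.

Lemma prop_eq_prod (I : eqType) (r : seq I) (F G : I -> R[i] -> R[i]) :
  (forall i, i \in r -> prop_eq (F i) (G i)) ->
  prop_eq (fun t => \prod_(i <- r) F i t) (fun t => \prod_(i <- r) G i t).
Proof.
elim: r => [|i r IH] FG; first by apply: prop_eq_ext => t; rewrite !big_nil.
have FGr : prop_eq (fun t => \prod_(i <- r) F i t) (fun t => \prod_(i <- r) G i t).
  by apply: IH => j jr; apply: FG; rewrite in_cons jr orbT.
apply: (@prop_eq_trans _ (fun t => F i t * \prod_(i <- r) F i t)).
  by apply: prop_eq_ext => t; rewrite big_cons.
apply: prop_eq_trans (prop_eqM (FG i (mem_head _ _)) FGr) _.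
by apply: prop_eq_ext => t; rewrite big_cons.
Qed.

Lemma prop_eq_affine f g a b d : (0 < a)%N -> (0 < d)%N -> prop_eq f g ->
  prop_eq (fun t => f (a%:R / d%:R * t + b%:R / d%:R))
          (fun t => g (a%:R / d%:R * t + b%:R / d%:R)).
Proof.
move=> a0 d0 [x x0 fg]; exists x => //.
apply: (mero_eq_comp_affine _ _ fg) => [|z].
  by rewrite mulf_neq0 ?invr_eq0 ?pnatr_eq0 -?lt0n.
rewrite /upper_half /= Im_affine => z0.
by rewrite mulr_gt0// divr_gt0// ltr0n.
Qed.

Definition has_lead f := exists c, leading_coef f c.

Lemma has_lead_prop_eq f g : prop_eq g f -> has_lead f -> has_lead g.
Proof.
move=> [x x0 gf] [c fc]; exists (x * c).
exact: leading_coef_mero_eq (mero_eq_sym gf) (leading_coefZ x0 fc).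
Qed.

Lemma has_lead_prod (I : eqType) (r : seq I) (F : I -> R[i] -> R[i]) :
  (forall i, i \in r -> has_lead (F i)) ->
  has_lead (fun t => \prod_(i <- r) F i t).
Proof.
elim: r => [|i r IH] H.
  by under eq_fun do rewrite big_nil; exists 1; exact: leading_coef1.
under eq_fun do rewrite big_cons.
have [c Hc] := H i (mem_head _ _).
have [d Hd] : has_lead (fun t => \prod_(i <- r) F i t).
  by apply: IH => j jr; apply: H; rewrite in_cons jr orbT.
by exists (c * d); exact: leading_coefM.
Qed.

Lemma has_lead_affine f a b d : (0 < a)%N -> (0 < d)%N -> has_lead f ->
  has_lead (fun t => f (a%:R / d%:R * t + b%:R / d%:R)).
Proof. by move=> a0 d0 [c]; exact: leading_coef_affine. Qed.

Lemma prop_eq_normalize f : has_lead f -> prop_eq (normalize f) f.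
Proof.
move=> [c fc]; rewrite (normalizeE fc); apply: prop_eq_scale.
by rewrite invr_neq0//; case: fc.
Qed.

(** If [g] is [x * f], its leading coefficient is [x * c], and [x] cancels on normalizing. *)
Lemma normalize_prop_eq f g : has_lead f -> prop_eq g f ->
  mero_eq (upper_half 0) (normalize f) (normalize g).
Proof.
move=> [c fc] [x x0 gf].
have gc := leading_coef_mero_eq (mero_eq_sym gf) (leading_coefZ x0 fc).
rewrite (normalizeE fc) (normalizeE gc); apply: mero_eq_sym.
apply: mero_eq_trans (mero_eqZ _ gf) _.
by apply: mero_eq_ext => z; rewrite invfM [_^-1 * _]mulrC -mulrA mulKf.
Qed.

End LeadingCoef.

(** * Products over complete residue systems *)

Section Hecke.
Variable R : realType.
Implicit Types (f g : R[i] -> R[i]).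

Lemma modn_coprimeMl_inj a q x y : coprime a q -> (x < q)%N -> (y < q)%N ->
  a * x = a * y %[mod q] -> x = y.
Proof.
wlog xy : x y / (x <= y)%N => [H aq xq yq E|aq xq yq /eqP].
  by case/orP: (leq_total x y) => ?; [exact: H|symmetry; exact: H].
rewrite eq_sym eqn_mod_dvd ?leq_mul// -mulnBr Gauss_dvdr 1?coprime_sym// => qxy.
by have [|/dvdn_leq/(_ qxy)] := posnP (y - x); lia.
Qed.

(* Covers both ways in which the shifts [b < d] and [j < p^r] combine into shifts modulo [d p^r]. *)
Lemma modn_ord_pair_inj a d q (dq0 : (0 < d * q)%N) : coprime a q ->
  injective (fun u : 'I_q * 'I_d => Ordinal (ltn_pmod (a * u.1 + u.2 * q) dq0)).
Proof.
move=> aq [x y] [x' y'] /= /(congr1 val)/= E.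
have q0 : (0 < q)%N by move: dq0; rewrite muln_gt0 => /andP[].
(* Modulo [q] the second summand disappears and [a] is invertible, which recovers the first
   component. *)
have xx : x = x'.
  apply/val_inj/(modn_coprimeMl_inj aq (ltn_ord x) (ltn_ord x')).
  move: (congr1 (modn^~ q) E); rewrite !modn_dvdm ?dvdn_mull//.
  by rewrite /= addnC modnMDl addnC modnMDl.
move: E; rewrite xx => /eqP; rewrite eqn_modDl => E; congr (_, _); move: E.
rewrite -!muln_modl !modn_small// eqn_pmul2r// => /eqP; exact: val_inj.
Qed.

(** Up to constants [phi] depends only on the index modulo [d * q]. The indices [a * x + y * q] are
    distinct modulo [d * q] and there are [d * q] of them, so each residue occurs once. *)
Lemma prop_eq_prod_residues (phi : nat -> R[i] -> R[i]) a d q :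
  (0 < d)%N -> (0 < q)%N -> coprime a q ->
  (forall c, prop_eq (phi (c + d * q)%N) (phi c)) ->
  prop_eq (fun t => \prod_(0 <= x < q) \prod_(0 <= y < d) phi (a * x + y * q)%N t)
          (fun t => \prod_(0 <= c < d * q) phi c t).
Proof.
move=> d0 q0 aq per; have dq0 : (0 < d * q)%N by rewrite muln_gt0 d0.
have perM k c : prop_eq (phi (k * (d * q) + c)%N) (phi c).
  elim: k => [|k IH]; first by apply: prop_eq_ext => t; rewrite mul0n.
  by apply: prop_eq_trans IH; rewrite mulSn -addnA addnC.
have per_mod c : prop_eq (phi c) (phi (c %% (d * q))%N).
  by rewrite {1}(divn_eq c (d * q)).
have := modn_ord_pair_inj (dq0 := dq0) aq; set sigma := (X in injective X) => sigma_inj.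
have sigma_bij : bijective sigma.
  by apply: inj_card_bij => //; rewrite card_prod !card_ord mulnC.
apply: (@prop_eq_trans _ _
  (fun t => \prod_(0 <= x < q) \prod_(0 <= y < d) phi ((a * x + y * q) %% (d * q))%N t)).
  apply: prop_eq_prod => x _; apply: prop_eq_prod => y _; exact: per_mod.
apply: prop_eq_ext => t; rewrite !big_mkord [RHS](reindex sigma)/=; last first.
  exact: onW_bij.
under eq_bigr do rewrite big_mkord.
by rewrite pair_bigA.
Qed.

(** * Hecke operators as products of translates *)

Lemma mx2E a b c d : (mx2 a b c d 0 0 = a) * (mx2 a b c d 0 1 = b) *
  (mx2 a b c d 1 0 = c) * (mx2 a b c d 1 1 = d).
Proof. by rewrite !mxE. Qed.

Lemma det_mx2 a b c d : \det (mx2 a b c d) = a * d - b * c.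
Proof. rewrite (expand_det_row _ 0) !big_ord_recl big_ord0 /cofactor !det_mx11 !mxE /=.
by rewrite expr0 expr1 mul1r mulN1r addr0 mulrN. Qed.

(** For an upper triangular matrix the automorphy factor is the constant [d], so the weight [k]
    enters only through a nonzero constant. *)
Lemma prop_eq_slash k (a b d : nat) f : (0 < a)%N -> (0 < d)%N ->
  prop_eq (slash k (mx2 a%:Z b%:Z 0 d%:Z) f)
    (fun t => f (a%:R / d%:R * t + b%:R / d%:R)).
Proof.
move=> a0 d0; rewrite /slash /moebius /autfac !mx2E det_mx2.
pose x : R[i] := (((a%:Z * d%:Z - b%:Z * 0)%:~R : R) `^ (k%:~R / 2))%:C * d%:R ^ (- k).
apply: (@prop_eq_trans _ _ (fun t => x * f (a%:R / d%:R * t + b%:R / d%:R))).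
  apply: prop_eq_ext => t; rewrite mul0r add0r; congr (_ * f _).
  by rewrite mulrDl mulrAC.
apply: prop_eq_scale; rewrite mulf_neq0//.
  rewrite fmorph_eq0 gt_eqF// powR_gt0// mulr0 subr0 rmorphM/=.
  by rewrite mulr_gt0// ltr0n.
by rewrite expfz_neq0// pnatr_eq0 -lt0n.
Qed.

(** The product behind [hecke] at a prime dividing the level, with constants and weight removed;
    [divisors_prod] is its analogue at the other primes. *)
Definition translates_prod (q : nat) f (t : R[i]) : R[i] :=
  \prod_(0 <= j < q) f (1%:R / q%:R * t + j%:R / q%:R).

Definition divisors_prod (n : nat) f (t : R[i]) : R[i] :=
  \prod_(d <- divisors n) \prod_(0 <= b < d)
    f ((n %/ d)%N%:R / d%:R * t + b%:R / d%:R).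

Lemma divisors_gt0 n d : (0 < n)%N -> d \in divisors n ->
  (0 < d)%N /\ (0 < n %/ d)%N.
Proof.
move=> n0; rewrite -dvdn_divisors// => dn.
have d0 := dvdn_gt0 n0 dn; split; first exact: d0.
by rewrite divn_gt0//; exact: dvdn_leq.
Qed.

Lemma has_lead_translates q f : (0 < q)%N -> has_lead f -> has_lead (translates_prod q f).
Proof.
by move=> q0 fl; apply: has_lead_prod => j _; exact: has_lead_affine.
Qed.

Lemma has_lead_divisors n f : (0 < n)%N -> has_lead f -> has_lead (divisors_prod n f).
Proof.
move=> n0 fl; apply: has_lead_prod => d /(divisors_gt0 n0)[d0 nd0].
by apply: has_lead_prod => b _; exact: has_lead_affine.
Qed.

Lemma prop_eq_translates q f g : (0 < q)%N -> prop_eq f g ->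
  prop_eq (translates_prod q f) (translates_prod q g).
Proof.
by move=> q0 fg; apply: prop_eq_prod => j _; exact: (prop_eq_affine j _ q0 fg).
Qed.

Lemma prop_eq_divisors n f g : (0 < n)%N -> prop_eq f g ->
  prop_eq (divisors_prod n f) (divisors_prod n g).
Proof.
move=> n0 fg; apply: prop_eq_prod => d /(divisors_gt0 n0)[d0 nd0].
by apply: prop_eq_prod => b _; exact: (prop_eq_affine b nd0 d0 fg).
Qed.

(** Separates normalization from the product: the power of [p] and the slash constants are nonzero,
    so [prop_eq] absorbs them. *)
Lemma hecke_dvd N p r (F : wform R) : (0 < p)%N -> (p %| N)%N ->
  exists2 g, wfun (hecke N p r F) = normalize g &
    prop_eq g (translates_prod (p ^ r) (wfun F)).
Proof.
move=> p0 pN; rewrite /hecke pN /=; eexists; first by [].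
apply: prop_eq_trans (prop_eq_scale _ _) _.
  by rewrite fmorph_eq0 gt_eqF// powR_gt0// ltr0n.
by apply: prop_eq_prod => j _; apply: prop_eq_slash; rewrite // expn_gt0 p0.
Qed.

Lemma hecke_ndvd N p r (F : wform R) : (0 < p)%N -> ~~ (p %| N)%N ->
  exists2 g, wfun (hecke N p r F) = normalize g &
    prop_eq g (divisors_prod (p ^ r) (wfun F)).
Proof.
move=> p0 /negPf pN; rewrite /hecke pN /=; eexists; first by [].
apply: prop_eq_trans (prop_eq_scale _ _) _.
  by rewrite fmorph_eq0 gt_eqF// powR_gt0// ltr0n.
have n0 : (0 < p ^ r)%N by rewrite expn_gt0 p0.
apply: prop_eq_prod => d /(divisors_gt0 n0)[d0 nd0].
by apply: prop_eq_prod => b _; exact: prop_eq_slash.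
Qed.

Lemma prop_eq_translates_divisors n q f : (0 < n)%N -> (0 < q)%N -> coprime n q ->
  prop_eq (fun t => f (t + 1)) f ->
  prop_eq (divisors_prod n (translates_prod q f)) (translates_prod q (divisors_prod n f)).
Proof.
move=> n0 q0 nq per.
pose phi d c t := f ((n %/ d)%N%:R / (d * q)%N%:R * t + c%:R / (d * q)%N%:R).
(* The common form of both composites: for each divisor [d], all shifts modulo [d * q]. *)
pose D t := \prod_(d <- divisors n) \prod_(0 <= c < d * q) phi d c t.
have perphi d c : d \in divisors n -> prop_eq (phi d (c + d * q)%N) (phi d c).
  move=> /(divisors_gt0 n0)[d0 nd0].
  have dq0 : (0 < d * q)%N by rewrite muln_gt0 d0.
  (* Raising [c] by [d * q] adds 1 to the argument of [f]. *)
  apply: prop_eq_trans (prop_eq_affine c nd0 dq0 per).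
  apply: prop_eq_ext => t; rewrite /phi natrD mulrDl divff ?addrA//.
  by rewrite pnatr_eq0 -lt0n.
apply: (@prop_eq_trans _ _ D).
  apply: prop_eq_prod => d dn; have [d0 nd0] := divisors_gt0 n0 dn.
  (* Here [d] and [q] exchange roles and the multiplier is 1: the shifts are [b + j * d]. *)
  have := @prop_eq_prod_residues (phi d) 1 q d q0 d0 (coprime1n _).
  rewrite [(q * d)%N]mulnC => /(_ (fun c => perphi d c dn)).
  apply: prop_eq_trans; apply: prop_eq_ext => t.
  apply: eq_bigr => b _; apply: eq_bigr => j _; congr f.
  rewrite mul1n natrD !natrM; field.
  rewrite !pnatr_eq0; lia.
apply: prop_eq_sym.
apply: (@prop_eq_trans _ _ (fun t => \prod_(d <- divisors n)
  \prod_(0 <= j < q) \prod_(0 <= b < d) phi d ((n %/ d) * j + b * q)%N t)).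
  apply: prop_eq_ext => t; rewrite /translates_prod /divisors_prod exchange_big/=.
  rewrite big_seq [RHS]big_seq; apply: eq_bigr => d dn.
  have [d0 nd0] := divisors_gt0 n0 dn.
  apply: eq_bigr => j _; apply: eq_bigr => b _; congr f.
  rewrite natrD !natrM; field.
  rewrite !pnatr_eq0; lia.
apply: prop_eq_prod => d dn; have [d0 nd0] := divisors_gt0 n0 dn.
apply: prop_eq_prod_residues => // [|c]; last exact: perphi.
apply: coprime_dvdl nq; rewrite -dvdn_divisors// in dn.
by rewrite -{2}(divnK dn) dvdn_mulr.
Qed.

(** * Forms in M(N) and commutation *)

(** Translation by 1 belongs to Gamma0(N) with automorphy factor 1; its multiplier has modulus 1,
    hence is nonzero. *)
Lemma in_M_shift N (F : wform R) : in_M N F ->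
  prop_eq (fun t => wfun F (t + 1)) (wfun F).
Proof.
case=> _ [chi hchi] _ _; pose T := mx2 1 1 0 1.
have TN : Gamma0 N T by rewrite /Gamma0 /SL2Z /T det_mx2 !mx2E dvdz0.
have [chi1 H] := hchi T TN; exists (chi T); first by rewrite -normr_eq0 chi1 oner_eq0.
apply: mero_eq_trans (mero_eq_trans _ H) _; apply: mero_eq_ext => t.
  by rewrite /moebius /autfac !mx2E mul1r mul0r add0r divr1.
by rewrite /autfac !mx2E mul0r add0r exp1rz mulr1.
Qed.

Lemma in_M_has_lead N (F : wform R) : in_M N F -> has_lead (wfun F).
Proof.
case=> _ _ _ [h [a [a0 fa]]]; exists 1; split; first exact: oner_neq0.
by exists 1%N, h, (fun n => (a n)%:~R); rewrite a0.
Qed.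

(** The inner normalization changes the inner function by a nonzero constant and the new weight
    changes the outer slashes by nonzero constants, so both composites reduce to the bare products;
    the outer normalization turns proportionality into equality. *)
Lemma hecke_comm N p l r s (F : wform R) :
  prime p -> prime l -> p != l -> (p %| N)%N -> ~~ (l %| N)%N -> in_M N F ->
  mero_eq (upper_half 0) (wfun (hecke N l s (hecke N p r F)))
    (wfun (hecke N p r (hecke N l s F))).
Proof.
move=> hp hl pl pN lN FM.
have [p0 l0] := (prime_gt0 hp, prime_gt0 hl).
have pr0 : (0 < p ^ r)%N by rewrite expn_gt0 p0.
have ls0 : (0 < l ^ s)%N by rewrite expn_gt0 l0.
have cop : coprime (l ^ s) (p ^ r).
  by rewrite coprimeXl// coprimeXr// prime_coprime// dvdn_prime2// eq_sym.
have lead := in_M_has_lead FM.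
have [gp Ep hgp] := hecke_dvd r F p0 pN.
have [gl El hgl] := hecke_ndvd s F l0 lN.
have [g1 -> hg1] := hecke_ndvd s (hecke N p r F) l0 lN.
have [g2 -> hg2] := hecke_dvd r (hecke N l s F) p0 pN.
have {Ep} : prop_eq (wfun (hecke N p r F)) (translates_prod (p ^ r) (wfun F)).
  rewrite Ep; apply: prop_eq_trans (prop_eq_normalize _) (hgp).
  exact: has_lead_prop_eq hgp (has_lead_translates _ _).
move/(prop_eq_divisors ls0)/(prop_eq_trans hg1) => {}hg1.
have {El} : prop_eq (wfun (hecke N l s F)) (divisors_prod (l ^ s) (wfun F)).
  rewrite El; apply: prop_eq_trans (prop_eq_normalize _) (hgl).
  exact: has_lead_prop_eq hgl (has_lead_divisors _ _).
move/(prop_eq_translates pr0)/(prop_eq_trans hg2) => {}hg2.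
apply: normalize_prop_eq.
  apply: has_lead_prop_eq hg1 _; apply: has_lead_divisors => //.
  exact: has_lead_translates.
apply: prop_eq_trans hg2 (prop_eq_sym (prop_eq_trans hg1 _)).
exact: prop_eq_translates_divisors ls0 pr0 cop (in_M_shift FM).
Qed.

End Hecke.

Theorem theorem3p9 (R : realType) (N p l s : nat)
    (hN : (1 <= N)%N) (hp : prime p) (hl : prime l) (hpl : p != l)
    (hpN : (p %| N)%N) (hlN : ~~ (l %| N)%N) (hs : (0 < s)%N) :
  (forall f : wform R, in_M N f ->
     mero_eq (upper_half 0%R)
       (wfun (hecke N l s (hecke N p 1 f)))
       (wfun (hecke N p 1 (hecke N l s f))))
  /\
  (forall r : nat, (1 <= r)%N -> forall f : wform R, in_M N f ->
     mero_eq (upper_half 0%R)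
       (wfun (hecke N l s (hecke N p r f)))
       (wfun (hecke N p r (hecke N l s f)))).
Proof. by split=> [f|r _ f] fM; exact: hecke_comm. Qed.
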